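(* Let $n\ge3$, let $\langle G\mid\mu_n\rangle$ and $\langle G'\mid\mu_n'\rangle$ be $n$-ary groups, let $e\in G$ and $e'\in G'$, and let $q$ be an admissible positive integer. Let $\langle G\mid\ast,e\rangle$, $\varphi_q$, $b_q$ be the binary group, map and element associated with $(\mu_n,e,q)$ by $$g\ast h=\mu_n[g,\mathbf{e}^{-1},h],\qquad \varphi_q(g)=\boldsymbol{\mu}_n^{\ell_\varphi(q)}\bigl[e,g,(\mathbf{e}^{-1})^q\bigr],\qquad b_q=\boldsymbol{\mu}_n^{\ell_e(q)}\bigl[e^{[[n]]_q}\bigr],$$ and let $\langle G'\mid\ast',e'\rangle$, $\varphi_q'$, $b_q'$ be associated in the same way with $(\mu_n',e',q)$. Let $\Phi^\ast:G\to G'$ be a homomorphism of binary groups from $\langle G\mid\ast,e\rangle$ to $\langle G'\mid\ast',e'\rangle$ such that $$\Phi^\ast(\varphi_q(g))=\varphi_q'(\Phi^\ast(g))\ \text{ for all } g\in G,\qquad \Phi^\ast(b_q)=b_q'.$$ Then $\Phi=\Phi^\ast$ is a homomorphism of $n$-ary groups, i.e. for all $g_1,\dots,g_n\in G$, $$\Phi^\ast(\mu_n[g_1,\ldots,g_n])=\mu_n'[\Phi^\ast(g_1),\ldots,\Phi^\ast(g_n)].$$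
   Context: $G$ and $G'$ are non-empty sets. An $n$-ary group $\langle G\mid\mu_n\rangle$ is $G$ with an operation $\mu_n:G^n\to G$ that is totally associative (in the composition of two copies of $\mu_n$ applied to $2n-1$ elements in a fixed order, the inner $\mu_n$ may be placed at any position without changing the value) and such that for every place $i=1,\dots,n$, the equation $\mu_n[u_1,\dots,u_{i-1},h,t_{i+1},\dots,t_n]=g$ has a unique solution $h\in G$ for any given $u_j,t_j,g\in G$. In polyads, $g^m$ denotes $m$ consecutive copies of $g$, and similarly $(\mathbf{t})^m$ is $m$ consecutive copies of a polyad (finite sequence) $\mathbf{t}$. The iterated product $\boldsymbol{\mu}_n^{\ell}$ is the $\ell$-fold composition of $\mu_n$ with itself, an operation on $\ell(n-1)+1$ arguments (well defined by associativity). A polyadic inverse of $e\in G$ is a polyad $\mathbf{e}^{-1}\in G^{n-2}$ such that $\mu_n[e,\mathbf{e}^{-1},h]=\mu_n[\mathbf{e}^{-1},e,h]=\mu_n[h,e,\mathbf{e}^{-1}]=\mu_n[h,\mathbf{e}^{-1},e]=h$ for all $h\in G$. In an $n$-ary group one exists for every $e$, e.g. $\mathbf{e}^{-1}=(e^{n-3},\bar e)$, where $\bar e$ is the unique solution of $\mu_n[e^{n-1},\bar e]=e$; fix one. With $g\ast h=\mu_n[g,\mathbf{e}^{-1},h]$, the set $G$ is a binary group with identity $e$. The $q$-deformed number is $[[k]]_q=\frac{q^k-1}{q-1}=1+q+\dots+q^{k-1}$ (so $[[k]]_1=k$). A positive integer $q$ is called admissible (for $n$) if $$\ell_\varphi(q)=\frac{q(n-2)+1}{n-1}\quad\text{and}\quad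 \ell_e(q)=q\,\frac{[[n-1]]_q}{n-1}$$ are both integers; then the numbers of arguments in the formulas for $\varphi_q$ and $b_q$ match the arities of the iterated products. *)

(* Defs.v *)
From mathcomp Require Import all_boot.
From mathcomp Require Import zify.

Set Implicit Arguments.
Unset Strict Implicit.
Unset Printing Implicit Defensive.

Section Operation.
Variables (n : nat) (T : Type) (mu : n.-tuple T -> T).

(* The decompositions u ++ w ++ v and u' ++ w' ++ v' are two placements of the
   inner operation, at positions size u and size u', in the same sequence;
   p and p' force its length to be 2n - 1. *)
Definition totally_associative : Prop :=
  forall (u v u' v' : seq T) (w w' : n.-tuple T)
         (p : size (u ++ mu w :: v) == n) (p' : size (u' ++ mu w' :: v') == n),
    u ++ w ++ v = u' ++ w' ++ v' -> mu (Tuple p) = mu (Tuple p').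

(* The place of the unknown is size u; p amounts to size u + size v = n - 1. *)
Definition uniquely_solvable : Prop :=
  forall (u v : seq T) (p : forall h, size (u ++ h :: v) == n) (g : T),
    exists! h, mu (Tuple (p h)) = g.

Definition nary_group : Prop := totally_associative /\ uniquely_solvable.

Lemma size_iter_take l (t : (l.+1 * n.-1).+1.-tuple T) : size (take n t) == n.
Proof. by rewrite size_takel // size_tuple mulSn; lia. Qed.

Lemma size_iter_drop l (t : (l.+1 * n.-1).+1.-tuple T) (x : T) :
  size (x :: drop n.-1.+1 t) == (l * n.-1).+1.
Proof. by rewrite /= size_drop size_tuple mulSn subSS addKn. Qed.

(* The inner products are nested in the first place. The tail drops n entries,
   since n.-1.+1 = n for the arities n >= 3 considered below. *)
Fixpoint iterated_product l : (l * n.-1).+1.-tuple T -> T :=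
  if l is l'.+1 then
    fun t => iterated_product
               (Tuple (size_iter_drop t (mu (Tuple (size_iter_take t)))))
  else fun t => thead t.

End Operation.

Definition qnumber (q k : nat) : nat := \sum_(i < k) q ^ i.

(* Integrality of the two fractions ell_phi and ell_e below. *)
Definition admissible (n q : nat) : Prop :=
  [/\ 0 < q, n.-1 %| q * (n - 2) + 1 & n.-1 %| q * qnumber q n.-1].

Definition ell_phi (n q : nat) : nat := (q * (n - 2) + 1) %/ n.-1.
Definition ell_e (n q : nat) : nat := (q * qnumber q n.-1) %/ n.-1.

Lemma qnumberS q k : qnumber q k.+1 = (q * qnumber q k).+1.
Proof.
rewrite /qnumber big_ord_recl expn0 add1n big_distrr /=.
by congr _.+1; apply: eq_bigr => i _; rewrite -expnS.
Qed.

Section AssociatedData.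
Variables (n : nat) (hn : 2 < n) (T : Type) (mu : n.-tuple T -> T).
Implicit Types (e g h : T) (einv : (n - 2).-tuple T).

Lemma size_xPy g einv h : size (g :: einv ++ [:: h]) == n.
Proof. by rewrite /= size_cat size_tuple /=; lia. Qed.

Lemma size_Pxy einv g h : size (einv ++ [:: g; h]) == n.
Proof. by rewrite size_cat size_tuple /=; lia. Qed.

Lemma size_xyP g h einv : size (g :: h :: einv) == n.
Proof. by rewrite /= size_tuple; lia. Qed.

Definition polyadic_inverse e einv : Prop :=
  forall h, [/\ mu (Tuple (size_xPy e einv h)) = h,
                mu (Tuple (size_Pxy einv e h)) = h,
                mu (Tuple (size_xyP h e einv)) = h
              & mu (Tuple (size_xPy h einv e)) = h].

Definition star einv g h : T := mu (Tuple (size_xPy g einv h)).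

Variables (q : nat) (hq : admissible n q).

Lemma size_phi_args e einv g :
  size (e :: g :: flatten (nseq q (tval einv))) == (ell_phi n q * n.-1).+1.
Proof.
case: hq => _ dvd_phi _; rewrite /ell_phi divnK //= size_flatten /shape map_nseq.
by rewrite sumn_nseq size_tuple addn1 mulnC.
Qed.

Lemma size_b_args e : size (nseq (qnumber q n) e) == (ell_e n q * n.-1).+1.
Proof.
case: hq => _ _ dvd_e; rewrite /ell_e divnK // size_nseq -qnumberS.
by rewrite prednK //; lia.
Qed.

Definition phi e einv g : T :=
  iterated_product mu (Tuple (size_phi_args e einv g)).

Definition b_elt e : T := iterated_product mu (Tuple (size_b_args e)).

End AssociatedData.

(* Main.v *)
(* Every polyad of length 1 mod n - 1 has a value independent of bracketing, and
   einv acts under evaluation as an inverse of e. Hence phi^k(g) is the value of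
   e^k g einv^(kq), and, since [[k+1]]_q = q [[k]]_q + 1, the partial products
     g_0 * phi^[[1]](g_1) * ... * phi^[[k]](g_k)
   telescope to g_0 ... g_k einv^(q[[k]]). For k = n - 1, multiplying by
   b = e^[[n]] cancels the remaining powers of einv, which expresses mu through
   star, phi and b only; Phi preserves these three. *)
Require Import Defs.
From mathcomp Require Import all_boot.
From mathcomp Require Import zify.

Set Implicit Arguments.
Unset Strict Implicit.
Unset Printing Implicit Defensive.

(** * Bracketing-independent evaluation of polyads *)

Section Evaluation.
Variables (n : nat) (T : Type) (mu : n.-tuple T -> T) (e : T).
Implicit Types (s u v w : seq T).

(* Junk value e when size s != n. *)
Definition seq_mu s : T := if insub s is Some t then mu t else e.

Lemma seq_muE (t : n.-tuple T) : seq_mu t = mu t.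
Proof. by rewrite /seq_mu valK. Qed.

Fixpoint eval_steps l s : T :=
  if l is l'.+1 then eval_steps l' (seq_mu (take n s) :: drop n s)
  else head e s.

(* Meaningful only when size s = 1 mod n - 1. *)
Definition eval s : T := eval_steps ((size s).-1 %/ n.-1) s.

Hypothesis hn : 2 < n.

Lemma iterated_productE l (t : (l * n.-1).+1.-tuple T) :
  iterated_product mu t = eval t.
Proof.
rewrite /eval size_tuple mulnK; last by lia.
elim: l t => [|l IHl] t /=; first by case: t => [[|x []]].
by rewrite IHl /= -seq_muE /= prednK //; lia.
Qed.

Hypothesis assoc_mu : totally_associative mu.

Lemma seq_mu_assoc u v w u' v' w' :
    size w = n -> size w' = n -> size (u ++ v) = n.-1 ->
    u ++ w ++ v = u' ++ w' ++ v' ->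
  seq_mu (u ++ seq_mu w :: v) = seq_mu (u' ++ seq_mu w' :: v').
Proof.
move=> /eqP sw /eqP sw' suv E.
have := congr1 size E; rewrite !size_cat => sE; rewrite size_cat in suv.
rewrite -[w]/(tval (Tuple sw)) -[w']/(tval (Tuple sw')) !seq_muE.
have p : size (u ++ mu (Tuple sw) :: v) == n by rewrite size_cat /=; lia.
have p' : size (u' ++ mu (Tuple sw') :: v') == n by rewrite size_cat /=; lia.
by rewrite (seq_muE (Tuple p)) (seq_muE (Tuple p')); apply: assoc_mu.
Qed.

(** Induction on the number of steps. If the first [n] entries lie in [u], both sides contract them
    and the induction hypothesis applies. Otherwise [w] ends within the first 2n - 1 entries, where
    associativity moves the inner product to the front. *)
Lemma eval_steps_contract l u w v :
    size w = n -> size (u ++ v) = l * n.-1 ->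
  eval_steps l.+1 (u ++ w ++ v) = eval_steps l (u ++ seq_mu w :: v).
Proof.
elim: l u v => [|l IHl] u v sw; rewrite size_cat => suv.
  have /nilP -> : nilp u by rewrite /nilp; lia.
  have /nilP -> : nilp v by rewrite /nilp; lia.
  by rewrite /= cats0 -sw take_size.
rewrite mulSn in suv; case: (leqP n (size u)) => [le_n_u | lt_u_n].
  rewrite -(cat_take_drop n u) -!catA.
  set u1 := take n u; set u2 := drop n u.
  have su1 : size u1 = n by rewrite size_takel.
  have su2 : size u2 = size u - n by rewrite size_drop.
  rewrite [LHS]/= [RHS]/= !take_size_cat // !drop_size_cat //.
  by rewrite -!cat_cons -IHl //= size_cat; lia.
(* [v1] pads [u ++ w] to exactly 2n - 1 entries: two steps on the left consume them, one on the
   right. *)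
have sv1 : size (take (n.-1 - size u) v) = n.-1 - size u.
  by rewrite size_takel // leq_subLR suv leq_addr.
rewrite -(cat_take_drop (n.-1 - size u) v).
set v1 := take _ v in sv1 *; set v2 := drop _ v.
set z := u ++ w ++ v1.
have sz : size z = n + n.-1 by rewrite !size_cat; lia.
have -> : u ++ w ++ v1 ++ v2 = take n z ++ drop n z ++ v2.
  by rewrite [RHS]catA cat_take_drop /z -!catA.
have sz1 : size (take n z) = n by rewrite size_takel // sz; lia.
have sz2 : size (drop n z) = n.-1 by rewrite size_drop sz; lia.
have -> : u ++ seq_mu w :: v1 ++ v2 = (u ++ seq_mu w :: v1) ++ v2.
  by rewrite -catA.
have su : size (u ++ seq_mu w :: v1) = n by rewrite size_cat /=; lia.
rewrite [RHS]/= (take_size_cat _ su) (drop_size_cat _ su).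
rewrite (seq_mu_assoc (u' := [::]) (v' := drop n z) (w' := take n z)) //;
  first last.
- by rewrite /= cat_take_drop.
- by rewrite size_cat; lia.
rewrite [LHS]/= (take_size_cat _ sz1) (drop_size_cat _ sz1) -!cat_cons.
have sz3 : size (seq_mu (take n z) :: drop n z) = n by rewrite /= sz2; lia.
by rewrite take_size_cat // drop_size_cat.
Qed.

Lemma eval_contract u w v :
    size w = n -> n.-1 %| size (u ++ v) ->
  eval (u ++ w ++ v) = eval (u ++ seq_mu w :: v).
Proof.
move=> sw /dvdnP[l suv]; rewrite /eval.
have -> : (size (u ++ w ++ v)).-1 = l.+1 * n.-1.
  by rewrite mulSn -suv !size_cat; lia.
have -> : (size (u ++ seq_mu w :: v)).-1 = l * n.-1.
  by rewrite -suv !size_cat /=; lia.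
by rewrite !mulnK ?eval_steps_contract //; lia.
Qed.

Lemma eval1 x : eval [:: x] = x.
Proof. by rewrite /eval /= div0n. Qed.

Lemma eval_mu (t : n.-tuple T) : eval t = mu t.
Proof.
rewrite -seq_muE -[in LHS](cats0 t) -[t ++ [::]]/([::] ++ t ++ [::]).
by rewrite eval_contract ?size_tuple // eval1.
Qed.

(** Induction on the number of products in [w]: its first [n] entries are contracted inside, and
    that contraction is undone in the outer polyad. *)
Lemma eval_nested u w v :
    0 < size w -> n.-1 %| (size w).-1 -> n.-1 %| size (u ++ v) ->
  eval (u ++ eval w :: v) = eval (u ++ w ++ v).
Proof.
move=> sw0 /dvdnP[l sw] suv; elim: l w sw0 sw => [|l IHl] w sw0 sw.
  by case: w sw0 sw => [|x []] //; rewrite eval1.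
rewrite mulSn in sw.
have sw1 : size (take n w) = n by rewrite size_takel //; lia.
have sw2 : size (drop n w) = l * n.-1 by rewrite size_drop; lia.
rewrite -[w](cat_take_drop n) -[take n w ++ _]/([::] ++ take n w ++ _).
rewrite [in LHS]eval_contract ?sw2 ?dvdn_mull // IHl //= ?sw2 // -catA.
rewrite eval_contract // size_cat size_cat sw2.
by rewrite addnCA dvdn_addr ?dvdn_mull // -size_cat.
Qed.

(** * Cancellation of the polyadic inverse *)

Variable einv : (n - 2).-tuple T.
Hypothesis heinv : polyadic_inverse hn mu e einv.

(** The last entry [x] of [u] absorbs the pair, since mu[x, einv, e] = x; hence [u] must be
    nonempty. *)
Lemma eval_cancel u v :
    0 < size u -> n.-1 %| (size (u ++ v)).-1 ->
  eval (u ++ einv ++ e :: v) = eval (u ++ v).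
Proof.
case/lastP: u => [//|u x] _.
rewrite !cat_rcons size_cat /= addnS /= -size_cat => suv.
have [_ _ _] := heinv x; rewrite -seq_muE /= => mux.
by rewrite -[in RHS]mux -eval_contract ?(eqP (size_xPy hn _ _ _)) //= -catA.
Qed.

Definition einv_pow k := flatten (nseq k (tval einv)).

Lemma size_einv_pow k : size (einv_pow k) = k * (n - 2).
Proof.
by rewrite size_flatten /shape map_nseq sumn_nseq size_tuple mulnC.
Qed.

Lemma einv_powD j k : einv_pow (j + k) = einv_pow j ++ einv_pow k.
Proof. by rewrite /einv_pow nseqD flatten_cat. Qed.

Lemma einv_powS k : einv_pow k.+1 = einv_pow k ++ einv.
Proof. by rewrite -addn1 einv_powD /einv_pow /= cats0. Qed.

Lemma eval_cancel_pow k u v :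
    0 < size u -> n.-1 %| (size (u ++ v)).-1 ->
  eval (u ++ einv_pow k ++ nseq k e ++ v) = eval (u ++ v).
Proof.
move=> su suv; elim: k => [//|k IHk].
rewrite einv_powS -!catA /=.
(* The innermost pair goes first: the last block [einv] against the first [e]. *)
rewrite (catA u) eval_cancel -?catA // ?size_cat; first by rewrite addn_gt0 su.
rewrite size_einv_pow size_nseq.
suff -> : (size u + (k * (n - 2) + (k + size v))).-1 = k * n.-1 + (size (u ++ v)).-1.
  by rewrite dvdn_addr ?dvdn_mull.
have -> : n.-1 = (n - 2).+1 by lia.
by rewrite mulnS size_cat; lia.
Qed.

Lemma star_eval u v :
    0 < size u -> n.-1 %| (size u).-1 -> 0 < size v -> n.-1 %| (size v).-1 ->
  star hn mu einv (eval u) (eval v) = eval (u ++ einv ++ v).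
Proof.
move=> su0 su sv0 sv; rewrite /star -eval_mu /=.
have size_einv1 : (size einv).+1 = n.-1 by rewrite size_tuple; lia.
rewrite (eval_nested (u := [::])) //=; last by rewrite size_cat addn1 size_einv1.
rewrite catA (eval_nested (v := [::])) ?cats0 -?catA // size_cat.
by rewrite -(prednK su0) addSnnS size_einv1 dvdn_addr.
Qed.

(** * Arities for admissible q, and the chain formula for mu *)

Variables (q : nat) (hq : admissible n q).

Lemma dvdn_phi_args : n.-1 %| (q * (n - 2)).+1.
Proof. by case: hq => _; rewrite addn1. Qed.

Lemma dvdn_pred_q : n.-1 %| q.-1.
Proof.
rewrite -(dvdn_addr _ dvdn_phi_args).
have -> : (q * (n - 2)).+1 + q.-1 = q * n.-1.
  have -> : n.-1 = (n - 2).+1 by lia.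
  by case: hq => q_gt0 _ _; rewrite mulnS; lia.
exact: dvdn_mull.
Qed.

(** Modulo n - 1 one has q = 1, hence [[k]] = k, and n - 2 = -1, so the sum is k - k. *)
Lemma dvdn_chain_args k : n.-1 %| k + q * qnumber q k * (n - 2).
Proof.
elim: k => [|k IHk]; first by rewrite /qnumber big_ord0 muln0.
rewrite qnumberS; set K := q * qnumber q k in IHk *.
have -> : k.+1 + q * K.+1 * (n - 2)
        = (q * (n - 2)).+1 + (k + K * (n - 2)) + K * (n - 2) * q.-1.
  by case: hq => q_gt0 _ _; rewrite -[in LHS](prednK q_gt0) -{2}(prednK q_gt0); nia.
exact: dvdn_add (dvdn_add dvdn_phi_args IHk) (dvdn_mull _ dvdn_pred_q).
Qed.

(** Each application of [phi] adds one [e] on the left and q blocks [einv] on the right. *)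
Lemma phi_iter_eval k g :
  iter k (phi mu hq e einv) g = eval (nseq k e ++ g :: einv_pow (k * q)).
Proof.
elim: k => [|k IHk]; first by rewrite /= eval1.
rewrite iterS IHk /phi iterated_productE /= -/(einv_pow q).
rewrite (eval_nested (u := [:: e])) /=.
- by rewrite -catA /= -einv_powD mulSn addnC.
- by rewrite size_cat /= addnS.
- rewrite size_cat size_nseq /= size_einv_pow addnS /= -mulnA -mulnS.
  by rewrite dvdn_mull ?dvdn_phi_args.
- by rewrite size_einv_pow dvdn_phi_args.
Qed.

(** An infinite sequence [gs] avoids bounds in the recursion; only its first k + 1 values matter. *)
Fixpoint phi_chain (gs : nat -> T) k : T :=
  if k is k'.+1 then
    star hn mu einv (phi_chain gs k')
      (iter (qnumber q k) (phi mu hq e einv) (gs k))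
  else gs 0.

Lemma dvdn_chain_size gs k :
  n.-1 %| (size (mkseq gs k.+1 ++ einv_pow (q * qnumber q k))).-1.
Proof. by rewrite size_cat size_mkseq size_einv_pow addSn dvdn_chain_args. Qed.

Lemma phi_chain_eval gs k :
  phi_chain gs k = eval (mkseq gs k.+1 ++ einv_pow (q * qnumber q k)).
Proof.
elim: k => [|k IHk]; first by rewrite /qnumber big_ord0 muln0 eval1.
rewrite [LHS]/= IHk phi_iter_eval star_eval ?dvdn_chain_size //.
(* The [einv] inserted by [star] raises q[[k]] blocks to [[k+1]], exactly the number of [e] in front
   of [gs k.+1]. *)
- rewrite -catA (catA (einv_pow _)) -einv_powS -qnumberS.
  rewrite eval_cancel_pow ?size_mkseq //.
    by rewrite [mkseq gs k.+2]mkseqS cat_rcons mulnC.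
  by rewrite -cat_rcons -mkseqS mulnC dvdn_chain_size.
- by rewrite size_cat /= addnS.
- rewrite size_cat size_nseq /= size_einv_pow addnS /= -mulnA -mulnS.
  by rewrite dvdn_mull ?dvdn_phi_args.
Qed.

Lemma mu_phi_chain gs (t : n.-tuple T) :
    tval t = mkseq gs n ->
  mu t = star hn mu einv (phi_chain gs n.-1) (b_elt hn mu hq e).
Proof.
move=> Et; have n_gt0 : 0 < n by lia.
have [_ _ dvd_b] := hq.
have size_b : (size (nseq (qnumber q n) e)).-1 = q * qnumber q n.-1.
  by rewrite size_nseq -[in LHS](prednK n_gt0) qnumberS.
rewrite phi_chain_eval /b_elt iterated_productE star_eval ?dvdn_chain_size //.
(* Likewise [[n]] blocks [einv] now meet the [[n]] copies of [e] in [b_elt], leaving only [t]. *)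
- rewrite -catA (catA (einv_pow _)) -einv_powS -qnumberS prednK //=.
  by rewrite -[nseq _ e]cats0 eval_cancel_pow ?cats0 -?Et ?eval_mu ?size_tuple.
- by rewrite size_nseq -(prednK n_gt0) qnumberS.
- by rewrite size_b.
Qed.

End Evaluation.

Theorem theorem5p1 (n : nat) (hn : 2 < n) (G G' : Type)
    (mu : n.-tuple G -> G) (mu' : n.-tuple G' -> G')
    (hmu : nary_group mu) (hmu' : nary_group mu')
    (e : G) (e' : G')
    (einv : (n - 2).-tuple G) (einv' : (n - 2).-tuple G')
    (heinv : polyadic_inverse hn mu e einv)
    (heinv' : polyadic_inverse hn mu' e' einv')
    (q : nat) (hq : admissible n q)
    (Phi : G -> G')
    (hstar : forall g h : G,
       Phi (star hn mu einv g h) = star hn mu' einv' (Phi g) (Phi h))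
    (hphi : forall g : G,
       Phi (phi mu hq e einv g) = phi mu' hq e' einv' (Phi g))
    (hb : Phi (b_elt hn mu hq e) = b_elt hn mu' hq e') :
  forall g : n.-tuple G, Phi (mu g) = mu' (map_tuple Phi g).
Proof.
move=> g; have [assoc_mu _] := hmu; have [assoc_mu' _] := hmu'.
(* The default [e] is never reached, as all indices are below n. *)
have Eg : tval g = mkseq (nth e g) n by rewrite -{1}(mkseq_nth e g) size_tuple.
have Eg' : tval (map_tuple Phi g) = mkseq (Phi \o nth e g) n.
  by rewrite /= [in LHS]Eg -map_comp.
rewrite (mu_phi_chain assoc_mu heinv hq Eg) (mu_phi_chain assoc_mu' heinv' hq Eg').
rewrite hstar hb; congr (star _ _ _ _ _).
(* [Phi] maps chains of every length to chains, so the length n - 1 is generalized for the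
   induction. *)
elim: n.-1 => //= k IHk; rewrite hstar IHk; congr (star _ _ _ _ _).
by elim: (qnumber q k.+1) => //= j IHj; rewrite hphi IHj.
Qed.
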